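(* Let $Q$ be a topological groupoid on a topological space $X$ and suppose there is an open cover $\mathcal{U}=\{U_i : i\in I\}$ of $X$ such that for all $i,j\in I$ and $x\in U_i\cap U_j$ there is an open set $W_x$ with $x\in W_x\subseteq U_i\cap U_j$ and there are (continuous) groupoid retractions $r_{i,W_x}: Q|U_i\to Q|W_x$ and $r_{j,W_x}:Q|U_j\to Q|W_x$ over retractions $U_i\to W_x$ and $U_j\to W_x$. Then a local subgroupoid $c_1(Q,\mathcal{U})$ of $Q$ is well defined by $x\mapsto [U_i,C_1(Q|U_i)]_x$ for $i\in I$, $x\in U_i$.
   Context: A groupoid $Q$ on $X$ has object set $X$, source $\alpha$ and target $\beta$; $gh$ is defined iff $\beta(g)=\alpha(h)$. A topological groupoid on $X$ has topologies on its set of arrows and on its object space $X$ making all structure maps continuous; subgroupoids get the subspace topology. A subgroupoid is wide if it has all objects. For $U\subseteq X$, $Q|U$ is the full subgroupoid on $U$ (and similarly $H|W$ for a subgroupoid $H$). A groupoid retraction $Q|U_i\to Q|W$ over a retraction $U_i\to W$ is a (continuous) groupoid morphism which restricts to the identity on $Q|W$ and whose map on objects is the given retraction. The star $\mathrm{St}_Q x$ is the set of arrows with source $x$. The star identity path component $C_1(Q)$ is the set of $g\in Q$ such that, with $x=\alpha(g)$, there is a path in $\mathrm{St}_Q x$ joining $g$ to $1_x$; it is a wide subgroupoid of $Q$. Local subgroupoids: for $x\in X$, consider pairs $(U,H)$ with $U$ an open neighbourhood of $x$ and $H$ a wide subgroupoid of $Q|U$. Pairs $(U,H)$, $(V,K)$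 have the same germ at $x$, $[U,H]_x=[V,K]_x$, iff $H|W=K|W$ for some open $W$ with $x\in W\subseteq U\cap V$. A local subgroupoid $s$ of $Q$ assigns to each $x\in X$ a germ $s(x)$ at $x$ such that each point of $X$ has an open neighbourhood $U$ and a wide subgroupoid $H$ of $Q|U$ with $s(y)=[U,H]_y$ for all $y\in U$ (equivalently, a continuous global section of the sheaf associated to the presheaf $U\mapsto\{\text{wide subgroupoids of } Q|U\}$). *)

(* Defs.v *)
From HB Require Import structures.
From mathcomp Require Import all_boot all_order all_algebra.
From mathcomp Require Import all_classical all_reals all_analysis.
Import Order.TTheory GRing.Theory Num.Theory numFieldNormedType.Exports.

Set Implicit Arguments.
Unset Strict Implicit.
Unset Printing Implicit Defensive.

Local Open Scope classical_set_scope.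
Local Open Scope ring_scope.

(* The product [gmul g h] is meaningful only when [gtgt g = gsrc h], and every
   axiom about it, including continuity, is restricted to composable pairs. *)
Record topGroupoid (X : topologicalType) := TopGroupoid {
  garrow :> topologicalType;
  gsrc : garrow -> X;
  gtgt : garrow -> X;
  gid : X -> garrow;
  ginv : garrow -> garrow;
  gmul : garrow -> garrow -> garrow;
  gsrc_id : forall x, gsrc (gid x) = x;
  gtgt_id : forall x, gtgt (gid x) = x;
  gsrc_inv : forall g, gsrc (ginv g) = gtgt g;
  gtgt_inv : forall g, gtgt (ginv g) = gsrc g;
  gsrc_mul : forall g h, gtgt g = gsrc h -> gsrc (gmul g h) = gsrc g;
  gtgt_mul : forall g h, gtgt g = gsrc h -> gtgt (gmul g h) = gtgt h;
  gmulA : forall g h k, gtgt g = gsrc h -> gtgt h = gsrc k ->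
    gmul g (gmul h k) = gmul (gmul g h) k;
  gmul1g : forall g, gmul (gid (gsrc g)) g = g;
  gmulg1 : forall g, gmul g (gid (gtgt g)) = g;
  gmulgV : forall g, gmul g (ginv g) = gid (gsrc g);
  gmulVg : forall g, gmul (ginv g) g = gid (gtgt g);
  gsrc_continuous : continuous gsrc;
  gtgt_continuous : continuous gtgt;
  gid_continuous : continuous gid;
  ginv_continuous : continuous ginv;
  gmul_continuous :
    {within [set gh : garrow * garrow | gtgt gh.1 = gsrc gh.2],
      continuous (fun gh : garrow * garrow => gmul gh.1 gh.2)} }.

Section TopGroupoidTheory.
Variables (X : topologicalType) (Q : topGroupoid X).
Implicit Types (U V W : set X) (H K : set Q) (x : X).

(* A subgroupoid is represented by its set of arrows, with the subspace
   topology; [full_sub U] is Q|U and [restr H W] is H|W. *)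
Definition full_sub U : set Q := [set g | U (gsrc g) /\ U (gtgt g)].

Definition restr H W : set Q := H `&` full_sub W.

Record wide_subgroupoid U H : Prop := WideSubgroupoid {
  wide_sub : H `<=` full_sub U;
  wide_id : forall x, U x -> H (gid Q x);
  wide_inv : forall g, H g -> H (ginv g);
  wide_mul : forall g h, H g -> H h -> gtgt g = gsrc h -> H (gmul g h) }.

(* Only the values of [r] on Q|U and of [rho] on U matter. *)
Record groupoid_retraction U W (r : Q -> Q) (rho : X -> X) : Prop :=
  GroupoidRetraction {
  retr_obj_continuous : {within U, continuous rho};
  retr_obj_sub : forall x, U x -> W (rho x);
  retr_obj_fix : forall x, W x -> rho x = x;
  retr_continuous : {within full_sub U, continuous r};
  retr_src : forall g, full_sub U g -> gsrc (r g) = rho (gsrc g);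
  retr_tgt : forall g, full_sub U g -> gtgt (r g) = rho (gtgt g);
  retr_id : forall x, U x -> r (gid Q x) = gid Q (rho x);
  retr_mul : forall g h, full_sub U g -> full_sub U h -> gtgt g = gsrc h ->
    r (gmul g h) = gmul (r g) (r h);
  retr_fix : forall g, full_sub W g -> r g = g }.

Definition star H x : set Q := [set g | H g /\ gsrc g = x].

(* A path in the subspace [star H x] is a path in Q with values in it. *)
Definition path_in (R : realType) (A : set Q) (g h : Q) : Prop :=
  exists gamma : R -> Q,
    [/\ {within `[0, 1]%classic, continuous gamma},
        forall t, `[0, 1]%classic t -> A (gamma t),
        gamma 0 = g & gamma 1 = h].

Definition C1 (R : realType) H : set Q :=
  [set g | H g /\ path_in R (star H (gsrc g)) g (gid Q (gsrc g))].

Definition local_pair x : set (set X * set Q) :=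
  [set p | [/\ open p.1, p.1 x & wide_subgroupoid p.1 p.2]].

Definition same_germ x (p q : set X * set Q) : Prop :=
  exists W, [/\ open W, W x, W `<=` p.1 `&` q.1 & restr p.2 W = restr q.2 W].

(* [germ U H x] is [U, H]_x, as an equivalence class of pairs. *)
Definition germ U H x : set (set X * set Q) :=
  [set q | local_pair x q /\ same_germ x (U, H) q].

Record local_subgroupoid := LocalSubgroupoid {
  local_germ :> X -> set (set X * set Q);
  local_germP : forall x, exists U H,
    [/\ open U, U x, wide_subgroupoid U H &
        forall y, U y -> local_germ y = germ U H y] }.

End TopGroupoidTheory.

Arguments full_sub {X} Q U.
Arguments groupoid_retraction {X} Q U W r rho.
Arguments local_subgroupoid {X} Q.

(* Main.v *)
Require Import Defs.
From HB Require Import structures.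
From mathcomp Require Import all_boot all_order all_algebra.
From mathcomp Require Import all_classical all_reals all_analysis.
From mathcomp Require Import lra.
Import Order.TTheory GRing.Theory Num.Theory numFieldNormedType.Exports.

Local Open Scope classical_set_scope.
Local Open Scope ring_scope.

(** The germs [U_i, C1(Q|U_i)]_x and [U_j, C1(Q|U_j)]_x agree because on the
    set W given by the retraction hypothesis both subgroupoids restrict to the
    same thing, namely C1(Q|W): see [restr_C1_retraction]. In one direction, a
    path in a star of Q|W is also a path in the corresponding star of Q|U_i, by
    inclusion. In the other, let g be an arrow of Q|W joined to 1_x by a path in
    the star of Q|U_i at x. A retraction r : Q|U_i -> Q|W sends this path into
    Q|W, keeps its source equal to x since r lies over a map fixing x, and fixes
    the end points g and 1_x, which are arrows of Q|W. Without a retraction the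
    second inclusion can fail, since the path may have to leave Q|W.

    Hence sending x to [U_i, C1(Q|U_i)]_x for an arbitrary i with U_i containing
    x does not depend on the choice of i, and near a point of U_i this
    assignment is given by the single pair (U_i, C1(Q|U_i)), so it is a local
    subgroupoid. A local subgroupoid is determined by its germs, which gives
    uniqueness.

    That C1(Q|U) is a wide subgroupoid, [C1_wide], comes from left translation:
    for g : x -> y, the map k |-> gk is continuous from the star at y to the
    star at x. It moves a path from h to 1_y to a path from gh to g, and, applied
    to the inverse of g, a path from g to 1_x to a path from 1_y to the inverse
    of g. *)

(** * Continuity on subspaces and paths *)

(** Continuity of [g] is assumed on [D] only, which is what is known of the
    multiplication, on composable pairs, and of a retraction, on Q|U. *)
Lemma within_continuous_comp_sub (S T V : topologicalType) (A : set S)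
    (D : set T) (f : S -> T) (g : T -> V) :
  (forall x, A x -> D (f x)) ->
  {within A, continuous f} -> {within D, continuous g} ->
  {within A, continuous (g \o f)}.
Proof.
move=> fAD /subspace_continuousP fc /subspace_continuousP gc.
apply/subspace_continuousP => x Ax.
have fx : f y @[y --> within A (nbhs x)] --> within D (nbhs (f x)).
  move=> B /(fc x Ax) fB.
  apply: (@filterS2 _ (within A (nbhs x)) _ _ _ _ _ fB (withinT A _)).
  by move=> y DB Ay; exact: DB (fAD y Ay).
exact: cvg_comp fx (gc _ (fAD x Ax)).
Qed.

Section Paths.
Variables (R : realType) (X : topologicalType) (Q : topGroupoid X).
Implicit Types (A B D : set Q) (g h k : Q).

Lemma path_in_refl A g : A g -> path_in R A g g.
Proof.
by move=> Ag; exists (fun=> g); split=> //; apply: continuous_subspaceT => t;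
  exact: cvg_cst.
Qed.

Lemma path_in_image A B D (f : Q -> Q) g h :
  A `<=` D -> {within D, continuous f} -> (forall k, A k -> B (f k)) ->
  path_in R A g h -> path_in R B (f g) (f h).
Proof.
move=> AD fc fAB [gamma [gc gA <- <-]]; exists (f \o gamma); split=> //.
- by apply: within_continuous_comp_sub gc fc => t /gA /AD.
- by move=> t /gA /fAB.
Qed.

Lemma path_in_sub A B g h : A `<=` B -> path_in R A g h -> path_in R B g h.
Proof.
by move=> AB [gamma [gc gA g0 g1]]; exists gamma; split=> // t /gA /AB.
Qed.

Lemma path_in_sym A g h : path_in R A g h -> path_in R A h g.
Proof.
move=> [gamma [gc gA g0 g1]]; exists (gamma \o (fun t => 1 - t)).
have rev01 (t : R) : `[0, 1]%classic t -> `[0, 1]%classic (1 - t).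
  by rewrite /= !in_itv /= => /andP[t0 t1]; apply/andP; split; lra.
split=> /=; rewrite ?subr0 ?subrr //.
- apply: within_continuous_comp_sub rev01 _ gc.
  by apply: continuous_subspaceT => t; apply: cvgB; [exact: cvg_cst|exact: cvg_id].
- by move=> t /rev01 /gA.
Qed.

Lemma path_in_trans A g h k :
  path_in R A g h -> path_in R A h k -> path_in R A g k.
Proof.
move=> [gamma [gc gA g0 g1]] [delta [dc dA d0 d1]].
pose conc (t : R) := if t <= 2^-1 then gamma (2 * t) else delta (2 * t - 1).
have first_half (t : R) :
    `[0, 2^-1]%classic t -> `[0, 1]%classic (2 * t).
  by rewrite /= !in_itv /= => /andP[t0 t1]; apply/andP; split; lra.
have second_half (t : R) :
    `[2^-1, 1]%classic t -> `[0, 1]%classic (2 * t - 1).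
  by rewrite /= !in_itv /= => /andP[t0 t1]; apply/andP; split; lra.
have halves : `[0, 1]%classic `<=` `[0, 2^-1]%classic `|` `[(2^-1 : R), 1]%classic.
  move=> t; rewrite /= !in_itv /= => /andP[t0 t1].
  by case: (lerP t 2^-1) => t2; [left|right]; rewrite ?t0 ?t1 ?(ltW t2).
have conc1 (t : R) : `[0, 2^-1]%classic t -> conc t = gamma (2 * t).
  by rewrite /= in_itv /= /conc => /andP[_ ->].
(* At the midpoint both formulas give h. *)
have conc2 (t : R) : `[2^-1, 1]%classic t -> conc t = delta (2 * t - 1).
  rewrite /= in_itv /= /conc => /andP[t2 _]; case: ifP => // t2'.
  have -> : t = 2^-1 by apply: le_anti; rewrite t2 t2'.
  by rewrite divff ?subrr ?g1 ?d0 // pnatr_eq0.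
exists conc; split.
- apply: (continuous_subspaceW halves); apply: withinU_continuous.
  + exact: interval_closed.
  + exact: interval_closed.
  + apply: (@subspace_eq_continuous _ _ _ (gamma \o (fun t => 2 * t))).
      by move=> t /set_mem /conc1.
    apply: within_continuous_comp_sub first_half _ gc.
    by apply: continuous_subspaceT => t; exact: mulrl_continuous.
  + apply: (@subspace_eq_continuous _ _ _ (delta \o (fun t => 2 * t - 1))).
      by move=> t /set_mem /conc2.
    apply: within_continuous_comp_sub second_half _ dc.
    apply: continuous_subspaceT => t.
    by apply: cvgB; [exact: mulrl_continuous|exact: cvg_cst].
- move=> t /halves[] th; first by rewrite conc1 //; apply/gA/first_half.
  by rewrite conc2 //; apply/dA/second_half.
- by rewrite conc1 ?mulr0 //= in_itv /=; apply/andP; split; lra.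
- rewrite conc2; last by rewrite /= in_itv /=; apply/andP; split; lra.
  by rewrite mulr1 (_ : 2 - 1 = 1 :> R) //; lra.
Qed.

End Paths.

(** * The star identity path component *)

Section StarComponent.
Variables (R : realType) (X : topologicalType) (Q : topGroupoid X).
Implicit Types (U W : set X) (H K : set Q) (g h k : Q).

Lemma full_sub_wide U : wide_subgroupoid U (full_sub Q U).
Proof.
split=> //.
- by move=> x Ux; rewrite /full_sub /= gsrc_id gtgt_id.
- by move=> g [gs gt]; rewrite /full_sub /= gsrc_inv gtgt_inv.
- by move=> g h [gs gt] [hs ht] gh; rewrite /full_sub /= gsrc_mul // gtgt_mul.
Qed.

Lemma full_subS U W : W `<=` U -> full_sub Q W `<=` full_sub Q U.
Proof. by move=> WU g [gs gt]; split; exact: WU. Qed.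

Lemma left_translation_continuous g :
  {within [set k | gtgt g = gsrc k], continuous (gmul g)}.
Proof.
have pairC : {within [set k | gtgt g = gsrc k],
    continuous (fun k : Q => (g, k))}.
  by apply: continuous_subspaceT => k; apply: cvg_pair;
    [exact: cvg_cst|exact: cvg_id].
exact: (within_continuous_comp_sub _ _ _ _ _ _ _ _ pairC
  (@gmul_continuous _ Q)).
Qed.

Lemma path_in_star_translate U H g h k : wide_subgroupoid U H -> H g ->
  path_in R (star H (gtgt g)) h k ->
  path_in R (star H (gsrc g)) (gmul g h) (gmul g k).
Proof.
move=> Hw Hg; apply: path_in_image (left_translation_continuous g) _.
- by move=> l [].
- by move=> l [Hl lg]; split; [exact: (wide_mul Hw)|rewrite gsrc_mul].
Qed.

(** Closure under inverses and products comes from translating paths: from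
    g ~ 1 one gets 1 ~ g^-1, and from h ~ 1 one gets gh ~ g, hence gh ~ 1. *)
Lemma C1_wide U H : wide_subgroupoid U H -> wide_subgroupoid U (C1 R H).
Proof.
move=> Hw; split.
- by move=> g [/(wide_sub Hw)].
- move=> x Ux; split; first exact: (wide_id Hw).
  rewrite gsrc_id; apply: path_in_refl.
  by split; [exact: (wide_id Hw)|exact: gsrc_id].
- move=> g [Hg gp]; have HVg := wide_inv Hw Hg; split=> //.
  rewrite -{1}(gtgt_inv g) in gp.
  have := path_in_star_translate _ _ _ _ _ Hw HVg gp.
  have -> : gmul (ginv g) (gid Q (gsrc g)) = ginv g.
    by rewrite -gtgt_inv gmulg1.
  by rewrite gmulVg gsrc_inv; exact: path_in_sym.
- move=> g h [Hg gp] [Hh hp] gh; split; first exact: (wide_mul Hw).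
  rewrite gsrc_mul //; apply: path_in_trans gp.
  rewrite -gh in hp.
  have := path_in_star_translate _ _ _ _ _ Hw Hg hp.
  by rewrite gmulg1.
Qed.

Lemma C1S H K : H `<=` K -> C1 R H `<=` C1 R K.
Proof.
move=> HK g [Hg gp]; split; first exact: HK.
by apply: path_in_sub gp => k [/HK].
Qed.

(** The retraction pushes a path in a star of Q|U, whose end points lie in Q|W,
    to a path in the star of Q|W with the same end points. *)
Lemma restr_C1_retraction U W (r : Q -> Q) (rho : X -> X) : W `<=` U ->
  groupoid_retraction Q U W r rho ->
  restr (C1 R (full_sub Q U)) W = C1 R (full_sub Q W).
Proof.
move=> WU rP; apply/seteqP; split=> [g [[Ug gp] Wg]|g Wg]; last first.
  by split; [exact: C1S (full_subS _ _ WU) _ Wg|case: Wg].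
have Wx : W (gsrc g) by case: Wg.
split=> //; have rg := retr_fix rP Wg.
have r1 := retr_fix rP (wide_id (full_sub_wide W) Wx).
have := path_in_image _ _ _ _ (star (full_sub Q W) (gsrc g)) _ _ _ _ _
  (@retr_continuous _ _ _ _ _ _ rP) _ gp.
rewrite rg r1; apply=> [k []//|k [Uk kx]].
have [Uks Ukt] := Uk.
split; last by rewrite (retr_src rP) // kx (retr_obj_fix rP).
by rewrite /full_sub /= (retr_src rP) // (retr_tgt rP) //; split;
  exact: (retr_obj_sub rP).
Qed.

End StarComponent.

(** * Germs and local subgroupoids *)

Section Germs.
Variables (X : topologicalType) (Q : topGroupoid X).
Implicit Types (x : X) (p q : set X * set Q).

Lemma restrI (H : set Q) (V W : set X) :
  restr H (V `&` W) = restr H V `&` full_sub Q W.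
Proof.
rewrite /restr -setIA; congr (_ `&` _).
by apply/seteqP; split=> g /= [[? ?] [? ?]].
Qed.

Lemma same_germ_sym x p q : same_germ x p q -> same_germ x q p.
Proof. by move=> [W [? ? ? e]]; exists W; split=> //; rewrite setIC. Qed.

Lemma same_germ_trans x p q q' :
  same_germ x p q -> same_germ x q q' -> same_germ x p q'.
Proof.
move=> [V [oV Vx Vpq eV]] [W [oW Wx Wqq eW]]; exists (V `&` W); split=> //.
- exact: openI.
- by move=> y [/Vpq[? _] /Wqq[_ ?]].
- by rewrite restrI eV -restrI setIC restrI eW -restrI setIC.
Qed.

Lemma same_germ_eq x (U V : set X) (H K : set Q) :
  same_germ x (U, H) (V, K) -> germ U H x = germ V K x.
Proof.
move=> e; apply/seteqP; split=> q [lq qe]; split=> //.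
- exact: same_germ_trans (same_germ_sym _ _ _ e) qe.
- exact: same_germ_trans e qe.
Qed.

Lemma local_subgroupoid_ext (s t : local_subgroupoid Q) : s =1 t -> s = t.
Proof.
case: s t => [s sP] [t tP] /= /funext st.
by case: _ / st in tP *; rewrite (Prop_irrelevance sP tP).
Qed.

End Germs.

Theorem proposition3p3 (R : realType) (X : topologicalType) (Q : topGroupoid X)
    (I : Type) (U : I -> set X)
    (Uopen : forall i, open (U i))
    (Ucover : \bigcup_i U i = setT)
    (Uretr : forall (i j : I) (x : X), (U i `&` U j) x ->
      exists W : set X,
        [/\ open W, W x, W `<=` U i `&` U j,
            exists (r : Q -> Q) (rho : X -> X),
              groupoid_retraction Q (U i) W r rho &
            exists (r : Q -> Q) (rho : X -> X),
              groupoid_retraction Q (U j) W r rho]) :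
  (forall i, wide_subgroupoid (U i) (C1 R (full_sub Q (U i)))) /\
  exists! s : local_subgroupoid Q,
    forall (i : I) (x : X), U i x ->
      s x = germ (U i) (C1 R (full_sub Q (U i))) x.
Proof.
have C1w i : wide_subgroupoid (U i) (C1 R (full_sub Q (U i))).
  exact/C1_wide/full_sub_wide.
split=> //.
have germ_indep i j x : U i x -> U j x ->
    germ (U i) (C1 R (full_sub Q (U i))) x =
    germ (U j) (C1 R (full_sub Q (U j))) x.
  move=> Uix Ujx; have [//|W [oW Wx WU [r [rho rP]] [r' [rho' rP']]]] := Uretr i j x.
  apply: same_germ_eq; exists W; split=> //=.
  rewrite (restr_C1_retraction _ _ _ _ _ _ _ _ rP) => [|y /WU[]//].
  by rewrite (restr_C1_retraction _ _ _ _ _ _ _ _ rP') => // y /WU[].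
have covered x : exists i, U i x.
  by have : (\bigcup_i U i) x by [rewrite Ucover]; case=> i _; exists i.
pose idx x := projT1 (cid (covered x)).
have Uidx x : U (idx x) x by exact: projT2 (cid (covered x)).
pose s x := germ (U (idx x)) (C1 R (full_sub Q (U (idx x)))) x.
have sP x : exists V H, [/\ open V, V x, wide_subgroupoid V H &
    forall y, V y -> s y = germ V H y].
  exists (U (idx x)), (C1 R (full_sub Q (U (idx x)))); split=> // y Uy.
  exact: germ_indep.
exists (LocalSubgroupoid sP); split=> [i x Uix|t tP]; first exact: germ_indep.
by apply: local_subgroupoid_ext => x; rewrite (tP _ _ (Uidx x)).
Qed.
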